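(* Let $k$ be an uncountable field of characteristic zero and let $R$ be an associative $k$-algebra (not necessarily commutative or unital). Let $\sigma:R\to R$ be a locally torsion $k$-algebra automorphism and let $\delta:R\to R$ be a $k$-linear locally nilpotent $\sigma$-derivation which is $q$-skew for some $q\in k\setminus\{0\}$. Then $$J(R[x;\sigma,\delta])=(J(R[x;\sigma,\delta])\cap R)[x;\sigma,\delta],$$ and $J(R[x;\sigma,\delta])\cap R$ is a nil ideal of $R$. Here $J$ denotes the Jacobson radical.
   Context: Rings and algebras are associative, noncommutative in general, and not necessarily unital; ''ideal'' means two-sided ideal. A $\sigma$-derivation is an additive map $\delta:R\to R$ with $\delta(ab)=\sigma(a)\delta(b)+\delta(a)b$ for all $a,b\in R$. It is $q$-skew (for $q\in k\setminus\{0\}$) if $q\sigma\delta=\delta\sigma$. It is locally nilpotent if for every $a\in R$ there is $n=n(a)$ with $\delta^n(a)=0$. The automorphism $\sigma$ is locally torsion if for every $a\in R$ there is a positive integer $n=n(a)$ with $\sigma^n(a)=a$. The Ore extension $R[x;\sigma,\delta]$ consists of the polynomials $a_0+a_1x+\cdots+a_nx^n$ with (left) coefficients $a_i\in R$, i.e. it is the free left $R$-module on $1,x,x^2,\dots$, with multiplication determined by $xr=\sigma(r)x+\delta(r)$ for $r\in R$. For an ideal $N$ of $R$ with $\sigma(N)\subseteq N$ and $\delta(N)\subseteq N$, $N[x;\sigma,\delta]$ denotes the set of elements $\sum_i a_ix^i$ of $R[x;\sigma,\delta]$ with all $a_i\in N$; it is a known fact that $N=J(R[x;\sigma,\delta])\cap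 R$ is stable under $\sigma$ and $\delta$ in this sense when $\sigma$ is an automorphism and $\delta$ is $q$-skew. The Jacobson radical is that of a possibly non-unital ring (the largest ideal all of whose elements are quasi-invertible, where $r$ is quasi-invertible if there is $s$ with $r+s+rs=0=r+s+sr$). An ideal is nil if each of its elements is nilpotent. *)

(* Defs.v *)
From HB Require Import structures.
From mathcomp Require Import all_boot all_order all_algebra finmap.
From mathcomp Require Import classical_sets cardinality.
From mathcomp Require Import monalg.

Set Implicit Arguments.
Unset Strict Implicit.
Unset Printing Implicit Defensive.

Import GRing.Theory.

Local Open Scope classical_set_scope.
Local Open Scope ring_scope.

(* The ring structures of MathComp all have a unit. A non-unital ring is an
   additive group and a multiplicative semigroup on the same carrier, so that
   its product is [mulg], written [(a * b)%g]. *)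
HB.mixin Record Zmodule_Semigroup_isNonUnitalRing R
    of GRing.Zmodule R & Semigroup R := {
  nu_mulDl : forall a b c : R, ((a + b)%R * c)%g = (a * c)%g + (b * c)%g;
  nu_mulDr : forall a b c : R, (a * (b + c)%R)%g = (a * b)%g + (a * c)%g
}.

#[short(type="nonUnitalRingType")]
HB.structure Definition NonUnitalRing :=
  { R of Zmodule_Semigroup_isNonUnitalRing R & GRing.Zmodule R & Semigroup R }.

HB.mixin Record NonUnitalRing_Lmodule_isNonUnitalAlg (k : nzRingType) R
    of NonUnitalRing R & GRing.Lmodule k R := {
  nu_scalerAl : forall (c : k) (a b : R), c *: (a * b)%g = ((c *: a) * b)%g;
  nu_scalerAr : forall (c : k) (a b : R), c *: (a * b)%g = (a * (c *: b))%g
}.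

#[short(type="nonUnitalAlgType")]
HB.structure Definition NonUnitalAlg (k : nzRingType) :=
  { R of NonUnitalRing_Lmodule_isNonUnitalAlg k R
       & NonUnitalRing R & GRing.Lmodule k R }.

Section NonUnitalRingTheory.
Variable R : nonUnitalRingType.
Implicit Types (a b c r s : R) (I : set R).

Lemma nu_mul0r a : (0%R * a)%g = 0 :> R.
Proof. by apply: (addrI (0 * a)%g); rewrite -nu_mulDl !addr0. Qed.

Lemma nu_mulr0 a : (a * 0%R)%g = 0 :> R.
Proof. by apply: (addrI (a * 0%R)%g); rewrite -nu_mulDr !addr0. Qed.

Definition two_sided_ideal I :=
  [/\ I 0,
      forall a b, I a -> I b -> I (a - b)
    & forall r a, I a -> I (r * a)%g /\ I (a * r)%g].

Definition quasi_invertible r :=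
  exists s, r + s + (r * s)%g = 0 /\ r + s + (s * r)%g = 0.

Definition quasi_invertible_ideal I :=
  two_sided_ideal I /\ forall r, I r -> quasi_invertible r.

(* The union of all the quasi-invertible ideals; it is itself one, hence the
   largest: [jacobson_quasi_invertible_ideal], [jacobson_largest]. *)
Definition jacobson : set R :=
  [set r | exists2 I, quasi_invertible_ideal I & I r].

(* [iter n ( *%g r) r] is the power of [r] of exponent [n.+1]. *)
Definition nu_nilpotent r := exists n, iter n (fun s => (r * s)%g) r = 0.

Definition nil_set I := forall r, I r -> nu_nilpotent r.

Let circ a b := a + b + (a * b)%g.

Let circA : associative circ.
Proof.
move=> a b c; rewrite /circ !(nu_mulDl, nu_mulDr) mulgA !addrA.
by rewrite [LHS](ACl (1*2*5*3*6*4*7)).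
Qed.

Let circ0r : left_id 0 circ.
Proof. by move=> a; rewrite /circ nu_mul0r add0r addr0. Qed.

Let circr0 : right_id 0 circ.
Proof. by move=> a; rewrite /circ nu_mulr0 !addr0. Qed.

Lemma ideal_add I a b : two_sided_ideal I -> I a -> I b -> I (a + b).
Proof.
by case=> I0 IB _ Ia Ib; rewrite -[b]opprK; apply: (IB) => //; rewrite -sub0r;
  apply: IB.
Qed.

Let quasi_invertibleD I r b : two_sided_ideal I ->
  (forall s, I s -> quasi_invertible s) ->
  quasi_invertible r -> I b -> quasi_invertible (r + b).
Proof.
move=> idI qI [s [rs sr]] Ib; have [_ _ IM] := idI.
have sr0 : circ s r = 0 by rewrite /circ [s + r]addrC.
have El : circ s (r + b) = b + (s * b)%g.
  rewrite -[RHS]add0r -sr0 /circ nu_mulDr !addrA.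
  by rewrite [LHS](ACl (1*2*4*3*5)).
have Er : circ (r + b) s = b + (b * s)%g.
  rewrite -[RHS]add0r -rs /circ nu_mulDl !addrA.
  by rewrite [LHS](ACl (1*3*4*2*5)).
have [c [_ cl]] : quasi_invertible (b + (s * b)%g).
  by apply: qI; apply: ideal_add => //; case: (IM s b Ib).
have [d [dr _]] : quasi_invertible (b + (b * s)%g).
  by apply: qI; apply: ideal_add => //; case: (IM s b Ib).
have Hl : circ (circ c s) (r + b) = 0.
  by rewrite -circA El /circ [c + _]addrC.
have Hr : circ (r + b) (circ s d) = 0 by rewrite circA Er.
have E : circ c s = circ s d.
  by rewrite -[LHS]circr0 -Hr circA Hl circ0r.
exists (circ s d); split; first exact: Hr.
by rewrite [r + b + _]addrC -E; exact: Hl.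
Qed.

Lemma jacobson_quasi_invertible_ideal : quasi_invertible_ideal jacobson.
Proof.
split; last by move=> r [I [_ qI]] /qI.
split.
- exists [set 0]; last by [].
  split; last first.
    by move=> _ ->; exists 0; rewrite nu_mulr0 !addr0.
  split=> [//|_ _ -> ->|r _ ->]; first by rewrite subr0.
  by rewrite nu_mulr0 nu_mul0r.
- move=> a b [I [idI qI] Ia] [K [idK qK] Kb].
  have [I0 IB IM] := idI; have [K0 KB KM] := idK.
  exists [set c | exists x y, [/\ I x, K y & c = x + y]]; last first.
    exists a, (- b); split=> //; rewrite -sub0r; exact: KB.
  split; last first.
    by move=> _ [x [y [Ix Ky ->]]]; exact: quasi_invertibleD (qI _ Ix) Ky.
  split.
  + by exists 0, 0; rewrite addr0.
  + move=> _ _ [x [y [Ix Ky ->]]] [x' [y' [Ix' Ky' ->]]].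
    exists (x - x'), (y - y'); split; [exact: IB|exact: KB|].
    by rewrite opprD addrACA.
  + move=> r _ [x [y [Ix Ky ->]]]; have [? ?] := IM r _ Ix.
    have [? ?] := KM r _ Ky.
    by split; [exists (r * x)%g, (r * y)%g|exists (x * r)%g, (y * r)%g];
       rewrite ?nu_mulDl ?nu_mulDr.
- move=> r a [I qI Ia]; have [[_ _ IM] _] := qI.
  by have [? ?] := IM r _ Ia; split; exists I.
Qed.

Lemma jacobson_largest I : quasi_invertible_ideal I -> I `<=` jacobson.
Proof. by move=> qI r Ir; exists I. Qed.

End NonUnitalRingTheory.

Arguments jacobson R : clear implicits.

(* Additivity of [delta] is not included: it comes with the type of [delta]. *)
Definition skew_derivation (R : nonUnitalRingType) (sigma delta : R -> R) :=
  forall a b : R,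
    delta (a * b)%g = (sigma a * delta b)%g + (delta a * b)%g.

(* The formal sum of the [a_i x^i] is the finitely supported function
   [i |-> a_i], an element of [{malg R[nat]}]; its coefficients are [p@_i] and
   [<< a *g i >>] is the monomial [a x^i]. *)
Section OreProduct.
Variables (R : nonUnitalRingType) (sigma delta : {additive R -> R}).
Implicit Types (p r : {malg R[nat]}) (a b : R).

Definition ore_lmul a p : {malg R[nat]} :=
  \sum_(j <- msupp p) << (a * p@_j)%g *g j >>.

(* The left multiplication by [x], read off [x b = sigma b x + delta b]. *)
Definition ore_xmul p : {malg R[nat]} :=
  \sum_(j <- msupp p) (<< sigma p@_j *g j.+1 >> + << delta p@_j *g j >>).

Definition ore_mul p r : {malg R[nat]} :=
  \sum_(i <- msupp p) ore_lmul p@_i (iter i ore_xmul r).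

End OreProduct.

Section MalgExtension.
Variables (G H : zmodType) (F : nat -> G -> H).
Hypothesis FD : forall i, {morph F i : a b / a + b}.

Let F0 i : F i 0 = 0.
Proof. by apply: (addrI (F i 0)); rewrite -FD !addr0. Qed.

Let ext (p : {malg G[nat]}) : H := \sum_(i <- msupp p) F i p@_i.

Let extw (p : {malg G[nat]}) (d : {fset nat}) :
  fsubset (msupp p) d -> ext p = \sum_(i <- d) F i p@_i.
Proof.
move=> pd; rewrite /ext; apply: big_fset_incl => // i _.
by rewrite -mcoeff_eq0 => /eqP ->.
Qed.

Lemma malg_extD (p r : {malg G[nat]}) :
  \sum_(i <- msupp (p + r)) F i (p + r)@_i
    = \sum_(i <- msupp p) F i p@_i + \sum_(i <- msupp r) F i r@_i.
Proof.
rewrite -!/(ext _) (extw (msuppD_le p r)) (extw (fsubsetUl _ (msupp r))).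
rewrite (extw (fsubsetUr (msupp p) _)) -big_split /=.
by apply: eq_bigr => i _; rewrite mcoeffD FD.
Qed.

Lemma malg_extU (a : G) i :
  \sum_(j <- msupp << a *g i >>) F j << a *g i >>@_j = F i a.
Proof.
by rewrite -/(ext _) (extw msuppU_le) big_seq_fset1 mcoeffUU.
Qed.

End MalgExtension.

Lemma malg_ind (G : zmodType) (P : {malg G[nat]} -> Prop) :
  P 0 -> (forall p r, P p -> P r -> P (p + r)) ->
  (forall a i, P << a *g i >>) -> forall p, P p.
Proof. by move=> P0 PD PU p; rewrite (monalgE p); elim/big_ind: _. Qed.

Section OreProductTheory.
Variables (R : nonUnitalRingType) (sigma delta : {additive R -> R}).
Hypothesis sigmaM : {morph sigma : a b / (a * b)%g}.
Hypothesis deltaM : skew_derivation sigma delta.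

Local Notation L := (@ore_lmul R).
Local Notation X := (ore_xmul sigma delta).
Local Notation mul := (ore_mul sigma delta).

Lemma ore_lmulU a b j : L a << b *g j >> = << (a * b)%g *g j >>.
Proof.
by apply: (malg_extU (F := fun j b => << (a * b)%g *g j >>)) => i x y /=;
  rewrite nu_mulDr monalgUD.
Qed.

Lemma ore_lmulDr a : {morph L a : p r / p + r}.
Proof.
move=> p r; apply: (malg_extD (F := fun j b => << (a * b)%g *g j >>)) => i x y /=.
by rewrite nu_mulDr monalgUD.
Qed.

Let additive0 (f : {malg R[nat]} -> {malg R[nat]}) :
  {morph f : p r / p + r} -> f 0 = 0.
Proof. by move=> fD; apply: (addrI (f 0)); rewrite -fD !addr0. Qed.

Lemma ore_lmulDl a b p : L (a + b) p = L a p + L b p.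
Proof.
elim/malg_ind: p => [|p r IHp IHr|c i].
- by rewrite !(additive0 (ore_lmulDr _)) addr0.
- by rewrite !ore_lmulDr IHp IHr addrACA.
- by rewrite !ore_lmulU nu_mulDl monalgUD.
Qed.

Lemma ore_lmulM a b p : L (a * b)%g p = L a (L b p).
Proof.
elim/malg_ind: p => [|p r IHp IHr|c i].
- by rewrite !(additive0 (ore_lmulDr _)).
- by rewrite !ore_lmulDr IHp IHr.
- by rewrite !ore_lmulU mulgA.
Qed.

Lemma ore_xmulU b j :
  X << b *g j >> = << sigma b *g j.+1 >> + << delta b *g j >>.
Proof.
apply: (malg_extU (F := fun j b => << sigma b *g j.+1 >> + << delta b *g j >>)).
by move=> i x y /=; rewrite !raddfD addrACA.
Qed.

Lemma ore_xmulD : {morph X : p r / p + r}.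
Proof.
move=> p r.
apply: (malg_extD (F := fun j b => << sigma b *g j.+1 >> + << delta b *g j >>)).
by move=> i x y /=; rewrite !raddfD addrACA.
Qed.

Let iterXD i : {morph iter i X : p r / p + r}.
Proof. by elim: i => // i IH p r /=; rewrite IH ore_xmulD. Qed.

Lemma ore_xmul_lmul a p : X (L a p) = L (sigma a) (X p) + L (delta a) p.
Proof.
elim/malg_ind: p => [|p r IHp IHr|c i].
- by rewrite !(additive0 (ore_lmulDr _)) (additive0 ore_xmulD)
    (additive0 (ore_lmulDr _)) addr0.
- by rewrite !(ore_lmulDr, ore_xmulD) IHp IHr addrACA.
- rewrite !(ore_lmulU, ore_xmulU) sigmaM deltaM ore_lmulDr !ore_lmulU.
  by rewrite monalgUD addrA.
Qed.

Lemma ore_mulUl a i p : mul << a *g i >> p = L a (iter i X p).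
Proof.
apply: (malg_extU (F := fun i a => L a (iter i X p))) => j x y /=.
by rewrite ore_lmulDl.
Qed.

Lemma ore_mulDl p r s : mul (p + r) s = mul p s + mul r s.
Proof.
apply: (malg_extD (F := fun i a => L a (iter i X s))) => j x y /=.
by rewrite ore_lmulDl.
Qed.

Lemma ore_mulDr p r s : mul p (r + s) = mul p r + mul p s.
Proof.
rewrite /ore_mul -big_split /=; apply: eq_bigr => i _.
by rewrite iterXD ore_lmulDr.
Qed.

Let mul0 p : mul 0 p = 0.
Proof.
by apply: (addrI (mul 0 p)); rewrite -ore_mulDl !addr0.
Qed.

Let mul_lmul a p r : mul (L a p) r = L a (mul p r).
Proof.
elim/malg_ind: p => [|p q IHp IHq|c i].
- by rewrite !(mul0, additive0 (ore_lmulDr _)).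
- by rewrite !(ore_lmulDr, ore_mulDl) IHp IHq.
- by rewrite ore_lmulU !ore_mulUl ore_lmulM.
Qed.

Let mul_xmul p r : mul (X p) r = X (mul p r).
Proof.
elim/malg_ind: p => [|p q IHp IHq|c i].
- by rewrite !(mul0, additive0 ore_xmulD).
- by rewrite !(ore_xmulD, ore_mulDl) IHp IHq.
- by rewrite ore_xmulU ore_mulDl !ore_mulUl ore_xmul_lmul.
Qed.

Let mul_iterX i p r : mul (iter i X p) r = iter i X (mul p r).
Proof. by elim: i => //= i IH; rewrite mul_xmul IH. Qed.

Lemma ore_mulA : associative mul.
Proof.
move=> p r s; elim/malg_ind: p => [|p q IHp IHq|c i].
- by rewrite !mul0.
- by rewrite !ore_mulDl IHp IHq.
- by rewrite !ore_mulUl mul_lmul mul_iterX.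
Qed.

End OreProductTheory.

(* The Ore extension [R[x; sigma, delta]]. The two proofs are arguments because
   the associativity of the product of the ring structure on this type
   depends on them. *)
Definition ore (R : nonUnitalRingType) (sigma delta : {additive R -> R})
    (sigmaM : {morph sigma : a b / (a * b)%g})
    (deltaM : skew_derivation sigma delta) : Type := {malg R[nat]}.

Section OreRing.
Variables (R : nonUnitalRingType) (sigma delta : {additive R -> R}).
Variables (sigmaM : {morph sigma : a b / (a * b)%g}).
Variables (deltaM : skew_derivation sigma delta).

Local Notation S := (ore sigmaM deltaM).

HB.instance Definition _ := GRing.Zmodule.copy S {malg R[nat]}.
HB.instance Definition _ := isSemigroup.Build S (ore_mulA sigmaM deltaM).
HB.instance Definition _ := Zmodule_Semigroup_isNonUnitalRing.Build S
  (@ore_mulDl R sigma delta) (@ore_mulDr R sigma delta).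

Definition ore_coef (i : nat) (p : S) : R := mcoeff i (p : {malg R[nat]}).

Definition ore_monomial (a : R) (i : nat) : S := << a *g i >>.

(* As [R] need not have a unit, [x] itself need not be an element of [S]; the
   rule [x b = sigma b x + delta b] is expressed by [ore_monomialSM]. The ring
   [R] is identified with the image of [ore_const], so that the intersection
   of [J : set S] with [R] is the preimage [ore_const @^-1` J]. *)
Definition ore_const (a : R) : S := ore_monomial a 0.

(* [N[x; sigma, delta]] *)
Definition ore_coefs_in (N : set R) : set S :=
  [set p | forall i, N (ore_coef i p)].

Lemma ore_coef_monomial a i j :
  ore_coef j (ore_monomial a i) = if i == j then a else 0.
Proof. by rewrite /ore_coef mcoeffU; case: eqP. Qed.

Lemma ore_ext (p r : S) : (forall i, ore_coef i p = ore_coef i r) -> p = r.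
Proof. by move=> /malgP. Qed.

Lemma ore_monomial0M (a b : R) (j : nat) :
  (ore_monomial a 0 * ore_monomial b j)%g = ore_monomial (a * b)%g j.
Proof. exact: etrans (ore_mulUl _ _ a 0 << b *g j >>) (ore_lmulU a b j). Qed.

Lemma ore_monomialSM (a b : R) (i j : nat) :
  (ore_monomial a i.+1 * ore_monomial b j)%g
    = (ore_monomial a i * ore_monomial (sigma b) j.+1)%g
      + (ore_monomial a i * ore_monomial (delta b) j)%g.
Proof.
rewrite -nu_mulDr; apply: etrans (ore_mulUl _ _ a i.+1 << b *g j >>) _.
by rewrite iterSr ore_xmulU; apply: esym; apply: ore_mulUl.
Qed.

End OreRing.

Definition locally_torsion (T : Type) (f : T -> T) :=
  forall a : T, exists n, (0 < n)%N /\ iter n f a = a.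

Definition locally_nilpotent (V : nmodType) (f : V -> V) :=
  forall a : V, exists n, iter n f a = 0.

Definition q_skew (k : nzRingType) (V : lmodType k) (q : k)
    (sigma delta : V -> V) :=
  forall a : V, q *: sigma (delta a) = delta (sigma a).

(* Main.v *)
Require Import Defs.
From HB Require Import structures.
From mathcomp Require Import all_boot all_order all_algebra finmap zify.
From mathcomp Require Import boolp classical_sets cardinality.
From mathcomp Require Import monalg.

(** Write [S] for the Ore extension, [J] for its Jacobson radical and [N] for
    the set of constants in [J].

    The shift. The automorphism [sigma] extends to an automorphism [theta] of
    [S] with [theta x = q^-1 x]. Adjoin to [S] a letter [u] with
    [u f = theta f u]. As [u a = sigma a u] for [a] in [R], the element [x + u]
    obeys the same rule [(x + u) a = sigma a (x + u) + delta a] as [x], so that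
    [f(x) |-> f(x + u) = \sum_j E_j(f) u^j] is multiplicative. The operators
    [E_j] (here [ore_qpartial]) are divided powers of a [q]-derivative in [x],
    and [E_n f] is the leading coefficient of [f] when [f] has degree [n].
    Hence the equality [J = N[x]] follows once [J] is stable under every [E_j]
    ([jacobson_qpartial], [jacobson_coef]).

    The uncountable field. If [c b] is quasi-invertible for every scalar [c],
    its quasi-inverse is the series of the [(- c b)^r] with [r >= 1], provided
    that the powers of [b] tend to [0] in a suitable filtration. This series is a polynomial,
    and its degree is bounded by the same [n] for infinitely many [c], because
    [k] is not a countable union of finite sets. The coefficients of index
    beyond [n] are polynomials in [c] with infinitely many roots, so they vanish
    identically, and [b] is nilpotent ([nilpotent_of_quasi_invertible_scale]).
    This is used twice.

    - For [f] in [J], the polynomial [f(x + u)] in [u] has no constant term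
      modulo [J], so it is nilpotent modulo [J] ([qpartial_nilpotent]). Suppose
      that [E_i] preserves [J] for [i < j]; the lowest term of [f(x + u)] modulo
      [J] is then [p u^j] with [p = E_j f]. Powers of [p u^j] are powers of [p]
      twisted by [theta], but [theta] has finite order on [f], and when [f] is
      replaced by a product [f * theta^e f * theta^(2 e) f ...] with a suitable
      [e] the two twists cancel: [p] is nilpotent modulo [J]
      ([qpartial_nilpotent_modulo]). Hence [J + E_j J] is an ideal which is nil
      modulo [J], and it is contained in [J].

    - For [a] in [N], the monomials [a x^m] are in [J]. If [m] exceeds the
      nilpotency index of [delta] at [a], then in a power of [a x^m] each letter
      [a] absorbs, through [delta], fewer than [m] factors [x]. The exponents of
      [x] that remain grow with the power ([delta_order_monomial_power]), every
      coefficient is eventually zero, and [a x^m] is nilpotent. When [sigma^m]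
      fixes [a], the leading coefficient of its [r]-th power is [a^r]
      ([jacobson_const_nilpotent]).

    The finite order of [theta] requires [q] to be a root of unity. This holds
    as soon as [delta <> 0], since [sigma^m] then fixes some [a] together with
    [delta a <> 0]; and if [delta = 0], one may take [q = 1]
    ([q_skew_root_of_unity]). *)

Set Implicit Arguments.
Unset Strict Implicit.
Unset Printing Implicit Defensive.

Import GRing.Theory.

Local Open Scope classical_set_scope.
Local Open Scope ring_scope.

(** The power of exponent [n.+1], in the form used by [nu_nilpotent]. *)
Notation nu_power r n := (iter n (fun s => (r * s)%g) r).

(** * The Jacobson radical of a non-unital ring *)

Section NonUnital.
Variable R : nonUnitalRingType.
Implicit Types (r s t w y z : R) (K : set R).
Local Notation J := (jacobson R).

Lemma nu_mulrN y z : (y * (- z))%g = - (y * z)%g.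
Proof. by apply/eqP; rewrite -addr_eq0 -nu_mulDr addNr nu_mulr0. Qed.

Lemma nu_mulNr y z : ((- y) * z)%g = - (y * z)%g.
Proof. by apply/eqP; rewrite -addr_eq0 -nu_mulDl addNr nu_mul0r. Qed.

Lemma nu_mulBl y z w : ((y - z) * w)%g = (y * w)%g - (z * w)%g.
Proof. by rewrite nu_mulDl nu_mulNr. Qed.

Lemma nu_mulBr y z w : (w * (y - z))%g = (w * y)%g - (w * z)%g.
Proof. by rewrite nu_mulDr nu_mulrN. Qed.

Lemma nu_power_power y m n :
  nu_power (nu_power y m) n = nu_power y (n * m.+1 + m).
Proof.
elim: n => // n IH; rewrite mulSn -addnA iterD -IH iterS.
move: (nu_power (nu_power y m) n) => z {n IH}.
by elim: m => //= m <-; rewrite mulgA.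
Qed.

Lemma jacobson_ideal : two_sided_ideal J.
Proof. by have [] := jacobson_quasi_invertible_ideal R. Qed.

Lemma jacobson_quasi_invertible y : J y -> quasi_invertible y.
Proof. by have [_] := jacobson_quasi_invertible_ideal R; apply. Qed.

Lemma jacobson0 : J 0.
Proof. by have [] := jacobson_ideal. Qed.

Lemma jacobsonD y z : J y -> J z -> J (y + z).
Proof. exact: ideal_add jacobson_ideal. Qed.

Lemma jacobsonB y z : J y -> J z -> J (y - z).
Proof. by have [_ JB _] := jacobson_ideal; apply: JB. Qed.

Lemma jacobsonN y : J y -> J (- y).
Proof. by rewrite -sub0r; apply: jacobsonB; apply: jacobson0. Qed.

Lemma jacobsonMl y z : J z -> J (y * z)%g.
Proof. by have [_ _ JM] := jacobson_ideal; case/(JM y). Qed.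

Lemma jacobsonMr y z : J y -> J (y * z)%g.
Proof. by have [_ _ JM] := jacobson_ideal; case/(JM z). Qed.

Lemma jacobson_sub y z : J (y - z) -> J z -> J y.
Proof. by move=> Jyz Jz; rewrite -[y](subrK z); apply: jacobsonD. Qed.

Lemma jacobson_sum (I : Type) (s : seq I) (P : pred I) (F : I -> R) :
  (forall i, P i -> J (F i)) -> J (\sum_(i <- s | P i) F i).
Proof.
by move=> JF; elim/big_ind: _ => //; [apply: jacobson0|apply: jacobsonD].
Qed.

Lemma nu_powerB y z n : J (y - z) -> J (nu_power y n - nu_power z n).
Proof.
move=> Jyz; elim: n => //= n IH.
have -> : (y * nu_power y n)%g - (z * nu_power z n)%g =
    (y * (nu_power y n - nu_power z n)%R)%g + ((y - z)%R * nu_power z n)%g.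
  by rewrite nu_mulBr nu_mulBl addrA subrK.
by apply: jacobsonD; [apply: jacobsonMl|apply: jacobsonMr].
Qed.

(** In the ring with an adjoined unit, [1 + circle y z = (1 + y) (1 + z)]. *)
Definition circle y z := y + z + (y * z)%g.

Lemma circleA : associative circle.
Proof.
move=> a b c; rewrite /circle !(nu_mulDl, nu_mulDr) mulgA !addrA.
by rewrite [LHS](ACl (1*2*5*3*6*4*7)).
Qed.

Lemma circle0r : left_id 0 circle.
Proof. by move=> a; rewrite /circle nu_mul0r add0r addr0. Qed.

Lemma circler0 : right_id 0 circle.
Proof. by move=> a; rewrite /circle nu_mulr0 !addr0. Qed.

Lemma quasi_invertible_circle y w :
  circle y w = circle w y -> quasi_invertible (circle y w) ->
  quasi_invertible y.
Proof.
move=> yw [s [ws sw]].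
have Hr : circle y (circle w s) = 0 by rewrite circleA.
have Hl : circle (circle s w) y = 0.
  by rewrite -circleA -yw /circle addrAC -sw addrAC [s + _]addrC.
have E : circle s w = circle w s.
  by rewrite -[LHS]circler0 -Hr circleA Hl circle0r.
exists (circle w s); split; first exact: Hr.
by rewrite [y + _]addrC -E; exact: Hl.
Qed.

(** In the ring with an adjoined unit, [1 + y] divides
    [1 - (- y) ^ n.+1], with a cofactor [1 + w] that commutes with [y]. *)
Lemma quasi_invertible_power n y : J (nu_power y n) -> quasi_invertible y.
Proof.
move=> Jyn.
suff [w yw Jw] : exists2 w, (y * w)%g = (w * y)%g & J (circle y w).
  apply: (@quasi_invertible_circle y w); first by rewrite /circle yw [y + w]addrC.
  exact: jacobson_quasi_invertible.
suff [w yw [Ew|Ew]] : exists2 w, (y * w)%g = (w * y)%g &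
    circle y w = nu_power y n \/ circle y w = - nu_power y n.
- by exists w => //; rewrite Ew.
- by exists w => //; rewrite Ew; apply: jacobsonN.
elim: n {Jyn} => [|n [w yw IH]].
  by exists 0; [rewrite nu_mulr0 nu_mul0r | left; rewrite circler0].
(* The new cofactor is [1 - y (1 + w)]. *)
exists (- y - (y * w)%g).
  by rewrite !(nu_mulBl, nu_mulBr, nu_mulrN, nu_mulNr) -mulgA yw.
suff -> : circle y (- y - (y * w)%g) = - (y * circle y w)%g.
  by case: IH => ->; [right|left]; rewrite ?nu_mulrN ?opprK.
rewrite /circle !(nu_mulBr, nu_mulDr, nu_mulrN) !opprD !addrA subrr add0r.
by rewrite [LHS](ACl (2*1*3)).
Qed.

(** The elements that carry [R] into [J] by left multiplication form an ideal,
    and their squares lie in [J]. This shows that [J] is stable under operations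
    on [R] that are not multiplications by elements of [R]: scalars, or the
    indeterminate of an Ore extension. *)
Lemma jacobson_mulr_all y : (forall s, J (y * s)%g) -> J y.
Proof.
move=> Jy; apply: (@jacobson_largest _ [set z | forall s, J (z * s)%g]) => //.
split; last by move=> r /= Jr; apply: (@quasi_invertible_power 1) => /=.
split=> [s|a b Ja Jb s|r a Ja /=]; first by rewrite nu_mul0r; apply: jacobson0.
  by rewrite nu_mulBl; apply: jacobsonB.
by split=> s; rewrite -mulgA; [apply: jacobsonMl|].
Qed.

Lemma jacobson_nil_modulo K : two_sided_ideal K ->
  (forall y, K y -> exists n, J (nu_power y n)) -> K `<=` J.
Proof.
move=> idK nilK; apply: jacobson_largest; split=> // y /nilK[n].
exact: quasi_invertible_power.
Qed.

Lemma jacobson_surjective_morph (f : R -> R) :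
  {morph f : a b / a + b} -> {morph f : a b / (a * b)%g} ->
  (forall b, exists a, f a = b) -> forall y, J y -> J (f y).
Proof.
move=> fD fM fsurj y [I [[I0 IB IM] qI] Iy].
have f0 : f 0 = 0 by apply: (addrI (f 0)); rewrite -fD !addr0.
have fB a b : f (a - b) = f a - f b.
  by apply: (addIr (f b)); rewrite -fD !subrK.
exists (f @` I); last by exists y.
split; last first.
  move=> _ [r /qI[s [rs sr]] <-]; exists (f s).
  by split; rewrite -fM -!fD ?rs ?sr.
split; first by exists 0.
- by move=> _ _ [a Ia <-] [b Ib <-]; exists (a - b); [apply: IB|].
- move=> r _ [a Ia <-]; have [r' <-] := fsurj r; have [? ?] := IM r' a Ia.
  by split; [exists (r' * a)%g|exists (a * r')%g].
Qed.

End NonUnital.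

Section NonUnitalAlgebra.
Variables (k : fieldType) (S : nonUnitalAlgType k).

Lemma jacobsonZ (c : k) (f : S) : jacobson S f -> jacobson S (c *: f).
Proof.
move=> Jf; apply: jacobson_mulr_all => g; rewrite -nu_scalerAl nu_scalerAr.
exact: jacobsonMr.
Qed.

Lemma nu_powerZ (c : k) (y : S) n :
  nu_power (c *: y) n = c ^+ n.+1 *: nu_power y n.
Proof.
elim: n => [|n /= ->]; first by rewrite expr1.
by rewrite -nu_scalerAl -nu_scalerAr scalerA -exprS.
Qed.

End NonUnitalAlgebra.

(** * Nilpotence over an uncountable field *)

Lemma infinite_set_uniq_seq (T : choiceType) (C : set T) (n : nat) :
  infinite_set C ->
  exists s : seq T, [/\ uniq s, size s = n & {in s, forall c, C c}].
Proof.
move=> Cinf; elim: n => [|n [s [us sn sC]]]; first by exists [::].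
have [c Cc cs] : exists2 c, C c & c \notin s.
  apply: contrapT => nc; apply: Cinf.
  apply: sub_finite_set (finite_seq s) => c Cc /=.
  by apply: contrapT => /negP cs; apply: nc; exists c.
exists (c :: s); rewrite /= cs us sn; split=> // d.
by rewrite inE => /predU1P[->|/sC].
Qed.

Lemma uncountable_bigcup (T : Type) (C : nat -> set T) :
  ~ countable [set: T] -> (forall x, exists n, C n x) ->
  exists n, infinite_set (C n).
Proof.
move=> uT CT; apply: contrapT => /forallNP finC; apply: uT.
suff -> : [set: T] = \bigcup_(n in [set: nat]) C n.
  apply: bigcup_countable => // n _; apply: finite_set_countable.
  exact: contrapT (finC n).
by apply/seteqP; split=> // x _; have [n ?] := CT x; exists n.
Qed.

Section Subspace.
Variables (k : fieldType) (V : lmodType k) (U : set V).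
Hypotheses (U0 : U 0) (UD : forall v w, U v -> U w -> U (v + w)).
Hypothesis UZ : forall c v, U v -> U (c *: v).

Lemma subspace_sum (I : Type) (s : seq I) (P : pred I) (F : I -> V) :
  (forall i, P i -> U (F i)) -> U (\sum_(i <- s | P i) F i).
Proof. by move=> UF; elim/big_ind: _. Qed.

(** A polynomial with coefficients in [V / U] and infinitely many roots is
    zero: the Vandermonde matrix of distinct roots is invertible. *)
Lemma subspace_polynomial_coef (N : nat) (v : 'I_N -> V) (C : set k) :
  infinite_set C -> (forall c, C c -> U (\sum_(r < N) c ^+ r *: v r)) ->
  forall r, U (v r).
Proof.
move=> /(@infinite_set_uniq_seq _ _ N)[s [us sN sC]] Cv.
pose a : 'rV[k]_N := \row_j s`_j.
pose A := Vandermonde N a.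
have uA : A \in unitmx.
  rewrite unitmxE det_Vandermonde unitfE prodf_seq_neq0; apply/allP => i _ /=.
  rewrite prodf_seq_neq0; apply/allP => j _; apply/implyP => ij.
  rewrite !mxE subr_eq0 nth_uniq ?sN //; apply: contraTneq ij => ->.
  by rewrite ltnn.
move=> r.
suff -> : v r = \sum_i invmx A i r *: \sum_(t < N) a 0 i ^+ t *: v t.
  apply: subspace_sum => i _; apply: UZ; apply: Cv; rewrite mxE; apply: sC.
  by rewrite mem_nth ?sN.
under eq_bigr do rewrite scaler_sumr.
rewrite exchange_big /=.
transitivity (\sum_t (A *m invmx A) t r *: v t).
  rewrite mulmxV // (bigD1 r) //= mxE eqxx scale1r big1 ?addr0 // => t tr.
  by rewrite mxE (negPf tr) scale0r.
apply: eq_bigr => t _; rewrite mxE scaler_suml; apply: eq_bigr => i _.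
by rewrite scalerA !mxE mulrC.
Qed.

End Subspace.

Section PowerSeries.
Variables (k : fieldType) (S : nonUnitalAlgType k) (V : lmodType k).
Variables (pi : nat -> {linear S -> V}) (U : set V) (b : S).
Hypothesis uncountable_k : ~ countable [set: k].
Hypotheses (U0 : U 0) (UD : forall v w, U v -> U w -> U (v + w)).
Hypothesis UZ : forall c v, U v -> U (c *: v).
Hypothesis pi_finite : forall s, exists n, forall i, (n <= i)%N -> U (pi i s).
Hypothesis pi_power : forall s i, exists n, forall r, (n <= r)%N ->
  U (pi i (iter r (fun t => (b * t)%g) s)).
Hypothesis qib : forall c : k, quasi_invertible (c *: b).

(** Think of the classes of [pi i s] in [V / U] as the coefficients of [s],
    which are those of a polynomial by [pi_finite]; by [pi_power], the powers
    of [b] tend to zero coefficientwise. *)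
Lemma nilpotent_of_quasi_invertible_scale :
  exists n, forall r i, (n <= r)%N -> U (pi i (nu_power b r)).
Proof.
pose B := fun t : S => (b * t)%g.
(* The scalars [c] such that the quasi-inverse of [c *: b] has degree less than
   [n]. *)
pose C n := [set c : k | exists s,
  s = - (c *: b) - (c *: B s) /\ forall i, (n <= i)%N -> U (pi i s)].
have /(uncountable_bigcup uncountable_k)[n Cinf] : forall c, exists n, C n c.
  move=> c; have [s [cs _]] := qib c; have [n ns] := pi_finite s.
  exists n, s; split=> //; rewrite -nu_scalerAl in cs.
  by apply/eqP; rewrite -opprD -addr_eq0 addrA [s + _]addrC; apply/eqP.
have expand c s N : s = - (c *: b) - (c *: B s) ->
    s = \sum_(r < N) (- c) ^+ r.+1 *: iter r B b + (- c) ^+ N *: iter N B s.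
  move=> Es; elim: N => [|N IH]; first by rewrite big_ord0 add0r expr0 scale1r.
  rewrite big_ord_recr /= -addrA {1}IH; congr (_ + _).
  rewrite {1}Es.
  have iterBD x y : iter N B (x + y) = iter N B x + iter N B y.
    by elim: N {IH} => //= m ->; rewrite /B nu_mulDr.
  have iterBZ x y : iter N B (x *: y) = x *: iter N B y.
    by elim: N {IH iterBD} => //= m ->; rewrite /B nu_scalerAr.
  by rewrite iterBD -!scaleNr !iterBZ scalerDr !scalerA -!exprSr -iterSr.
have Uhigh i : (n <= i)%N -> forall r, U (pi i (iter r B b)).
  move=> ni; have [N HN] := pi_power b i.
  (* For [c] in [C n], the [i]-th coefficient of the quasi-inverse of [c *: b]
     is the polynomial in [c] with coefficients [v], whose length does not
     depend on [c]. *)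
  pose v (r : 'I_N.+1) :=
    if r is Ordinal r'.+1 _ then (-1) ^+ r'.+1 *: pi i (iter r' B b) else 0.
  have Uv : forall r, U (v r).
    apply: (subspace_polynomial_coef U0 UD UZ Cinf) => c [s [Es Us]].
    have [N' HN'] := pi_power s i.
    pose M := maxn N N'.
    have := congr1 (pi i) (expand c s M Es).
    rewrite linearD linearZ linear_sum /=.
    rewrite -(big_mkord xpredT (fun r => pi i ((- c) ^+ r.+1 *: iter r B b))).
    rewrite (big_cat_nat (leq0n N) (leq_maxl N N')) /= big_mkord => Epi.
    rewrite big_ord_recl /= scaler0 add0r.
    under eq_bigr => r _ do
      rewrite /= /bump /= add1n scalerA -exprMn mulrN1 -linearZ /=.
    have -> : \sum_(r < N) pi i ((- c) ^+ r.+1 *: iter r B b) =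
        pi i s + (-1) *: (\sum_(N <= r < M) pi i ((- c) ^+ r.+1 *: iter r B b)
        + (- c) ^+ M *: pi i (iter M B s)).
      by rewrite scaleN1r Epi -[X in _ = X - _]addrA addrK.
    apply: (UD (Us i ni)); apply: (UZ); apply: UD.
      rewrite big_nat_cond; apply: subspace_sum => // r /andP[/andP[Nr _] _].
      by rewrite linearZ; apply: (UZ); apply: HN.
    by apply: (UZ); apply: HN'; apply: leq_maxr.
  move=> r; have [/HN//|rN] := leqP N r.
  have := UZ ((-1) ^+ r.+1) (Uv (@Ordinal N.+1 r.+1 rN)).
  by rewrite /= scalerA -exprD -signr_odd oddD addbb expr0 scale1r.
have : exists N, forall i, (i < n)%N ->
    forall r, (N <= r)%N -> U (pi i (iter r B b)).
  elim: n {Cinf Uhigh} => [|m [N HN]]; first by exists 0%N.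
  have [N' HN'] := pi_power b m; exists (maxn N N') => i.
  rewrite ltnS leq_eqVlt => /predU1P[->|im] r; rewrite geq_max => /andP[Nr N'r].
    exact: HN'.
  exact: HN.
case=> N HN; exists N => r i Nr; have [ni|ni] := leqP n i; first exact: Uhigh.
exact: HN.
Qed.

End PowerSeries.

(** * Coefficients and products in an Ore extension *)

Section OreCoefficients.
Variables (R : nonUnitalRingType) (sigma delta : {additive R -> R}).
Variables (sigmaM : {morph sigma : a b / (a * b)%g}).
Variables (deltaM : skew_derivation sigma delta).
Local Notation S := (ore sigmaM deltaM).
Local Notation C := (ore_const sigmaM deltaM).
Local Notation M := (ore_monomial sigmaM deltaM).
Implicit Types (f g h : S) (a b : R).

Lemma ore_coef_is_zmod_morphism i : zmod_morphism (ore_coef i : S -> R).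
Proof. by move=> f g; rewrite /ore_coef mcoeffB. Qed.

HB.instance Definition _ i := GRing.isZmodMorphism.Build S R
  (ore_coef i : S -> R) (ore_coef_is_zmod_morphism i).

(** A strict bound on the degree. *)
Definition ore_bound f : nat := (\max_(i <- msupp f) i).+1.

Lemma ore_coef_bound f i : (ore_bound f <= i)%N -> ore_coef i f = 0.
Proof.
move=> fi; apply: mcoeff_outdom; apply: contraTN fi => fi.
rewrite -ltnNge ltnS.
exact: (@leq_bigmax_seq _ _ xpredT (fun i : nat => i)).
Qed.

Definition ore_build n (F : nat -> R) : S := \sum_(i < n) M (F i) i.

Lemma ore_coef_build n F i : (forall i, (n <= i)%N -> F i = 0) ->
  ore_coef i (ore_build n F) = F i.
Proof.
move=> F0; rewrite raddf_sum /=; under eq_bigr do rewrite ore_coef_monomial.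
have [/F0 Fi|ni] := leqP n i.
  by rewrite Fi big1 // => j _; case: eqP => // ->.
rewrite (bigD1 (Ordinal ni)) //= eqxx big1 ?addr0 // => j.
by rewrite -val_eqE /=; case: eqP.
Qed.

Lemma ore_sum_monomials f : f = \sum_(i < ore_bound f) M (ore_coef i f) i.
Proof.
apply: ore_ext => i.
rewrite [RHS](ore_coef_build (F := fun i => ore_coef i f)) //.
exact: ore_coef_bound.
Qed.

Lemma ore_monomial0 i : M 0 i = 0.
Proof. exact: monalgU0. Qed.

Lemma ore_monomialD i : {morph M^~ i : a b / a + b}.
Proof. by move=> a b; apply: monalgUD. Qed.

Lemma ore_additive_eq (V : zmodType) (F G : S -> V) :
  {morph F : f g / f + g} -> {morph G : f g / f + g} ->
  (forall a i, F (M a i) = G (M a i)) -> F =1 G.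
Proof.
move=> FD GD FG; apply: malg_ind => [|f g Ff Gf|a i]; last exact: FG.
  have F0 : F 0 = 0 by apply: (addrI (F 0)); rewrite -FD !addr0.
  by rewrite F0; apply: (addrI (G 0)); rewrite -GD !addr0.
by rewrite FD GD Ff Gf.
Qed.

(** Left multiplication by [x], which need not be an element of [S]. *)
Definition ore_x f : S := ore_xmul sigma delta f.

Lemma ore_xD : {morph ore_x : f g / f + g}.
Proof. exact: ore_xmulD. Qed.

Lemma ore_x_monomial a i : ore_x (M a i) = M (sigma a) i.+1 + M (delta a) i.
Proof. exact: ore_xmulU. Qed.

Lemma ore_coef0_x f : ore_coef 0 (ore_x f) = delta (ore_coef 0 f).
Proof.
move: f; apply: ore_additive_eq => [f g|f g|a i]; rewrite ?ore_xD ?raddfD //=.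
rewrite ore_x_monomial raddfD /= !ore_coef_monomial add0r.
by case: eqP; rewrite ?raddf0.
Qed.

Lemma ore_coefS_x f i :
  ore_coef i.+1 (ore_x f) = sigma (ore_coef i f) + delta (ore_coef i.+1 f).
Proof.
move: f; apply: ore_additive_eq => [f g|f g|a j].
- by rewrite ore_xD raddfD.
- by rewrite !raddfD /= addrACA.
rewrite ore_x_monomial raddfD /= !ore_coef_monomial eqSS.
by case: eqP; case: eqP; rewrite ?raddf0.
Qed.

Lemma ore_coef_constM a f i :
  ore_coef i (C a * f)%g = (a * ore_coef i f)%g.
Proof.
move: f; apply: ore_additive_eq => [f g|f g|b j]; rewrite ?nu_mulDr ?raddfD //=.
  by rewrite nu_mulDr.
by rewrite ore_monomial0M !ore_coef_monomial; case: eqP; rewrite ?nu_mulr0.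
Qed.

Lemma ore_monomialM a i g : (M a i * g)%g = (C a * iter i ore_x g)%g.
Proof.
apply: etrans (ore_mulUl _ _ a i g) _.
by apply: etrans (esym (ore_mulUl _ _ a 0 _)).
Qed.

Lemma ore_x_constM a g :
  ore_x (C a * g)%g = (C (sigma a) * ore_x g)%g + (C (delta a) * g)%g.
Proof.
apply: ore_ext => -[|i];
  rewrite raddfD /= ?(ore_coef0_x, ore_coefS_x, ore_coef_constM).
  by rewrite deltaM.
by rewrite sigmaM deltaM nu_mulDr addrA.
Qed.

Lemma ore_xM f g : (ore_x f * g)%g = ore_x (f * g)%g.
Proof.
move: f; apply: ore_additive_eq => [f h|f h|a i].
- by rewrite ore_xD nu_mulDl.
- by rewrite nu_mulDl ore_xD.
rewrite ore_x_monomial nu_mulDl !(ore_monomialM _ i) (ore_monomialM _ i.+1).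
by rewrite iterS ore_x_constM.
Qed.

(** Since [sigma] is onto, [x] and the constants generate:
    [sigma a x^i.+1 = x (a x^i) - delta a x^i]. *)
Lemma ore_ind (P : S -> Prop) : (forall b, exists a, sigma a = b) ->
  (forall f g, P f -> P g -> P (f + g)) ->
  (forall a, P (C a)) -> (forall f, P f -> P (ore_x f)) ->
  forall f, P f.
Proof.
move=> ssurj PD PC Px.
have P0 : P 0 by have := PC 0; rewrite /ore_const ore_monomial0.
have PU a i : P (M a i).
  elim: i a => // i IH a; have [b <-] := ssurj a.
  have -> : M (sigma b) i.+1 = ore_x (M b i) + M (- delta b) i.
    by rewrite ore_x_monomial -addrA -ore_monomialD subrr ore_monomial0 addr0.
  by apply: PD; [apply: Px|].
by apply: malg_ind => //; exact: PD.
Qed.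

(** Right multiplication by [x]. *)
Definition ore_mulx f : S := ore_build (ore_bound f).+1
  (fun i => if i is i'.+1 then ore_coef i' f else 0).

Lemma ore_coef_mulx f i :
  ore_coef i (ore_mulx f) = if i is i'.+1 then ore_coef i' f else 0.
Proof. by rewrite ore_coef_build // => -[//|j] /ore_coef_bound. Qed.

Lemma ore_mulx_monomial a i : ore_mulx (M a i) = M a i.+1.
Proof.
by apply: ore_ext => -[|j]; rewrite ore_coef_mulx !ore_coef_monomial.
Qed.

Lemma ore_mulxM f g : (ore_mulx f * g)%g = (f * ore_x g)%g.
Proof.
move: f; apply: ore_additive_eq => [f h|f h|a i].
- rewrite -nu_mulDl; congr (_ * g)%g; apply: ore_ext => -[|i].
    by rewrite raddfD /= !ore_coef_mulx addr0.
  by rewrite raddfD /= !ore_coef_mulx raddfD.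
- by rewrite nu_mulDl.
by rewrite ore_mulx_monomial (ore_monomialM _ i) (ore_monomialM _ i.+1) iterSr.
Qed.

Lemma jacobson_mulx f : jacobson S f -> jacobson S (ore_mulx f).
Proof.
move=> Jf; apply: jacobson_mulr_all => s; rewrite ore_mulxM.
exact: jacobsonMr.
Qed.

Lemma jacobson_monomial a n : jacobson S (C a) -> jacobson S (M a n).
Proof.
move=> Ja; elim: n => // n; rewrite -ore_mulx_monomial; exact: jacobson_mulx.
Qed.

Lemma jacobson_of_coefs f :
  (forall i, jacobson S (C (ore_coef i f))) -> jacobson S f.
Proof.
move=> Jf; rewrite (ore_sum_monomials f).
by apply: jacobson_sum => i _; apply: jacobson_monomial.
Qed.

End OreCoefficients.

(** * The Ore extension of an algebra *)

Section OreAlgebra.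
Variables (k : fieldType) (R : nonUnitalAlgType k).
Variables (sigma delta : {linear R -> R}).
Variables (sigmaM : {morph sigma : a b / (a * b)%g}).
Variables (deltaM : skew_derivation sigma delta).
Local Notation S := (ore sigmaM deltaM).
Local Notation M := (ore_monomial sigmaM deltaM).
Local Notation X := (@ore_x R sigma delta sigmaM deltaM).
Implicit Types (f g h : S) (a b : R) (c d : k).

Definition ore_scale c f : S :=
  ore_build sigmaM deltaM (ore_bound f) (fun i => c *: ore_coef i f).

Lemma ore_coef_scale c f i : ore_coef i (ore_scale c f) = c *: ore_coef i f.
Proof. by rewrite ore_coef_build // => j /ore_coef_bound ->; rewrite scaler0. Qed.

Lemma ore_scaleA c d f : ore_scale c (ore_scale d f) = ore_scale (c * d) f.
Proof. by apply: ore_ext => i; rewrite !ore_coef_scale scalerA. Qed.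

Lemma ore_scale1 : left_id 1 ore_scale.
Proof. by move=> f; apply: ore_ext => i; rewrite ore_coef_scale scale1r. Qed.

Lemma ore_scaleDr : right_distributive ore_scale +%R.
Proof.
move=> c f g; apply: ore_ext => i.
by rewrite raddfD /= !ore_coef_scale raddfD scalerDr.
Qed.

Lemma ore_scaleDl f : {morph ore_scale^~ f : c d / c + d}.
Proof.
by move=> c d; apply: ore_ext => i; rewrite raddfD /= !ore_coef_scale scalerDl.
Qed.

HB.instance Definition _ := GRing.Zmodule_isLmodule.Build k S
  ore_scaleA ore_scale1 ore_scaleDr ore_scaleDl.

Lemma ore_coefZ c f i : ore_coef i (c *: f) = c *: ore_coef i f.
Proof. exact: ore_coef_scale. Qed.

Lemma ore_coef_is_scalable i : scalable (ore_coef i : S -> R).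
Proof. by move=> c f; apply: ore_coefZ. Qed.

HB.instance Definition _ i := GRing.isScalable.Build k S R *:%R
  (ore_coef i : S -> R) (@ore_coef_is_scalable i).

Lemma ore_x_is_linear : linear X.
Proof.
move=> c f g; rewrite ore_xD; congr (_ + _); apply: ore_ext => -[|i].
  by rewrite ore_coefZ !ore_coef0_x ore_coefZ /= linearZ.
by rewrite ore_coefZ !ore_coefS_x !ore_coefZ /= !linearZ scalerDr.
Qed.

HB.instance Definition _ := GRing.isLinear.Build k S S *:%R X ore_x_is_linear.

Lemma ore_scaleAl c f g : c *: (f * g)%g = ((c *: f) * g)%g.
Proof.
move: f; apply: ore_additive_eq => [f h|f h|a i].
- by rewrite nu_mulDl scalerDr.
- by rewrite scalerDr nu_mulDl.
have -> : c *: M a i = M (c *: a) i.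
  apply: ore_ext => j; rewrite ore_coefZ !ore_coef_monomial.
  by case: eqP; rewrite ?scaler0.
rewrite !(ore_monomialM _ i); apply: ore_ext => j.
by rewrite ore_coefZ !ore_coef_constM nu_scalerAl.
Qed.

Lemma iter_ore_xZ c f i : iter i X (c *: f) = c *: iter i X f.
Proof. by elim: i => //= i ->; rewrite linearZ. Qed.

Lemma ore_scaleAr c f g : c *: (f * g)%g = (f * (c *: g))%g.
Proof.
move: f; apply: ore_additive_eq => [f h|f h|a i].
- by rewrite nu_mulDl scalerDr.
- by rewrite nu_mulDl.
rewrite !(ore_monomialM _ i) iter_ore_xZ; apply: ore_ext => j.
by rewrite ore_coefZ !ore_coef_constM ore_coefZ nu_scalerAr.
Qed.

HB.instance Definition _ := NonUnitalRing_Lmodule_isNonUnitalAlg.Build k S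
  ore_scaleAl ore_scaleAr.

End OreAlgebra.

(** * Local torsion *)

Lemma iter_fixed (T : Type) (F : T -> T) n m x :
  iter n F x = x -> iter (m * n) F x = x.
Proof. by move=> Fx; elim: m => //= m IH; rewrite mulSn iterD IH. Qed.

Lemma iter_linear0 (k : nzRingType) (V : lmodType k) (F : {linear V -> V}) n :
  iter n F 0 = 0.
Proof. by elim: n => //= n ->; rewrite linear0. Qed.

Lemma locally_torsion_common (T : Type) (sigma : T -> T) (F : nat -> T) n :
  locally_torsion sigma ->
  exists2 m, (0 < m)%N & forall i, (i < n)%N -> iter m sigma (F i) = F i.
Proof.
move=> tors; elim: n => [|n [m m0 IH]]; first by exists 1%N.
have [m' [m'0 Em']] := tors (F n).
exists (m * m')%N; first by rewrite muln_gt0 m0.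
move=> i; rewrite ltnS leq_eqVlt => /predU1P[->|im]; first exact: iter_fixed.
by rewrite mulnC; apply: iter_fixed; apply: IH.
Qed.

(** If [sigma^n] fixes both [a] and [delta a], then
    [delta a = delta (sigma^n a) = q^n sigma^n (delta a) = q^n delta a]. *)
Lemma q_skew_root_of_unity (k : fieldType) (R : nonUnitalAlgType k)
    (sigma delta : {linear R -> R}) (q : k) :
  q_skew q sigma delta -> locally_torsion sigma -> q != 0 ->
  exists q', [/\ q' != 0, q_skew q' sigma delta
               & exists2 e, (0 < e)%N & q' ^+ e = 1].
Proof.
move=> qskew tors q0.
have [delta0|/existsNP[a /eqP da]] := pselect (forall a, delta a = 0).
  exists 1; split; first exact: oner_neq0.
    by move=> a; rewrite !delta0 linear0 scaler0.
  by exists 1%N.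
have [m [m0 am]] := tors a; have [m' [m'0 dam]] := tors (delta a).
exists q; split=> //; exists (m * m')%N; first by rewrite muln_gt0 m0.
have E n : delta (iter n sigma a) = q ^+ n *: iter n sigma (delta a).
  elim: n => [|n IH] /=; first by rewrite scale1r.
  by rewrite -qskew IH linearZ /= scalerA -exprS.
have := E (m * m')%N.
rewrite (iter_fixed m dam) [in LHS]mulnC (iter_fixed m' am) => /eqP.
rewrite -subr_eq0 -{1}[delta a]scale1r -scalerBl scaler_eq0 (negPf da) orbF.
by rewrite subr_eq0 => /eqP.
Qed.

(** * The shift of the indeterminate *)

(** The coefficient of [x^i u^j] in [(x + u)^(i + j)], for [u x = q^-1 x u]. *)
Fixpoint gauss_binomial (k : fieldType) (q : k) (i : nat) {struct i} :
    nat -> k :=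
  fix gauss_binomial_i j := match i, j with
  | i'.+1, j'.+1 => gauss_binomial q i' j + q ^- i * gauss_binomial_i j'
  | _, _ => 1
  end.

Arguments gauss_binomial : simpl never.

Section Shift.
Variables (k : fieldType) (R : nonUnitalAlgType k).
Variables (sigma delta : {linear R -> R}) (q : k).
Variables (sigmaM : {morph sigma : a b / (a * b)%g}).
Variables (deltaM : skew_derivation sigma delta).
Hypotheses (q0 : q != 0) (qskew : q_skew q sigma delta).
Hypothesis sigma_surj : forall b, exists a, sigma a = b.
Local Notation S := (ore sigmaM deltaM).
Local Notation C := (ore_const sigmaM deltaM).
Local Notation M := (ore_monomial sigmaM deltaM).
Local Notation X := (@ore_x R sigma delta sigmaM deltaM).
Local Notation J := (jacobson S).
Local Notation gbin := (gauss_binomial q).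
Implicit Types (f g h s y z : S) (a b : R) (c : k).

(** The ring automorphism that extends [sigma] and maps [x] to [q^-1 x]. *)
Definition theta f : S := ore_build sigmaM deltaM (ore_bound f)
  (fun i => q ^- i *: sigma (ore_coef i f)).

Lemma ore_coef_theta f i :
  ore_coef i (theta f) = q ^- i *: sigma (ore_coef i f).
Proof.
by rewrite ore_coef_build // => j /ore_coef_bound ->; rewrite linear0 scaler0.
Qed.

Lemma theta_is_linear : linear theta.
Proof.
move=> c f g; apply: ore_ext => i.
by rewrite linearP /= !ore_coef_theta linearP /= linearP scalerDr !scalerA mulrC.
Qed.

HB.instance Definition _ :=
  GRing.isLinear.Build k S S *:%R theta theta_is_linear.

Lemma theta_const a : theta (C a) = C (sigma a).
Proof.
apply: ore_ext => -[|i]; rewrite ore_coef_theta !ore_coef_monomial.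
  by rewrite expr0 invr1 scale1r.
by rewrite linear0 scaler0.
Qed.

Lemma theta_constM a g : theta (C a * g)%g = (C (sigma a) * theta g)%g.
Proof.
apply: ore_ext => i; rewrite ore_coef_theta !ore_coef_constM ore_coef_theta.
by rewrite sigmaM nu_scalerAr.
Qed.

Lemma theta_x g : theta (X g) = q^-1 *: X (theta g).
Proof.
have qsk a : sigma (delta a) = q^-1 *: delta (sigma a).
  by rewrite -qskew scalerA mulVf // scale1r.
apply: ore_ext => -[|i]; rewrite ore_coefZ ore_coef_theta.
  by rewrite !ore_coef0_x ore_coef_theta !expr0 !invr1 !scale1r qsk.
rewrite !ore_coefS_x /= !ore_coef_theta linearD /= qsk !linearZ /=.
rewrite !scalerDr !scalerA -!invfM -exprS.
by rewrite [in q * q ^+ i.+1]mulrC.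
Qed.

Lemma thetaM : {morph theta : f g / (f * g)%g}.
Proof.
move=> f g; move: f; apply: ore_ind => // [f h IHf IHh|a|f IH].
- by rewrite nu_mulDl !linearD /= nu_mulDl IHf IHh.
- by rewrite theta_constM theta_const.
- by rewrite ore_xM !theta_x IH -nu_scalerAl ore_xM.
Qed.

Lemma theta_surj g : exists f, theta f = g.
Proof.
have ex i : exists a, q ^- i *: sigma a = ore_coef i g.
  have [a Ea] := sigma_surj (ore_coef i g); exists (q ^+ i *: a).
  by rewrite linearZ scalerA mulVf ?expf_neq0 // scale1r.
pose F i := if (i < ore_bound g)%N then projT1 (cid (ex i)) else 0.
exists (ore_build sigmaM deltaM (ore_bound g) F); apply: ore_ext => i.
rewrite ore_coef_theta ore_coef_build; last by move=> j; rewrite /F ltnNge => ->.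
rewrite /F; case: ltnP => [_|/ore_coef_bound ->]; last by rewrite linear0 scaler0.
by case: cid.
Qed.

Lemma jacobson_theta f : J f -> J (theta f).
Proof.
by apply: jacobson_surjective_morph thetaM theta_surj _; apply: linearD.
Qed.

Lemma jacobson_iter_theta n f : J f -> J (iter n theta f).
Proof. by move=> Jf; elim: n => //= n; apply: jacobson_theta. Qed.

Lemma iter_thetaM n f g :
  iter n theta (f * g)%g = (iter n theta f * iter n theta g)%g.
Proof. by elim: n => //= n ->; rewrite thetaM. Qed.

Lemma iter_thetaZ n c f : iter n theta (c *: f) = c *: iter n theta f.
Proof. by elim: n => //= n ->; rewrite linearZ. Qed.

Lemma gauss_binomial0r i : gbin i 0 = 1. Proof. by case: i. Qed.

Lemma gauss_binomial0l j : gbin 0 j = 1. Proof. by case: j. Qed.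

Lemma gauss_binomialSS i j :
  gbin i.+1 j.+1 = gbin i j.+1 + q ^- i.+1 * gbin i.+1 j.
Proof. by []. Qed.

(** The coefficient of [u^j] in [f(x + u)], where [u g = theta g u]. *)
Definition ore_qpartial (j : nat) f : S :=
  ore_build sigmaM deltaM (ore_bound f) (fun i => gbin i j *: ore_coef (i + j) f).

Local Notation E := ore_qpartial.

Lemma ore_coef_qpartial j f i :
  ore_coef i (E j f) = gbin i j *: ore_coef (i + j) f.
Proof.
rewrite ore_coef_build // => l fl; rewrite ore_coef_bound ?scaler0 //.
exact: leq_trans fl (leq_addr _ _).
Qed.

Lemma qpartial_is_linear j : linear (E j).
Proof.
move=> c f g; apply: ore_ext => i; rewrite linearP /= !ore_coef_qpartial.
by rewrite linearP /= scalerDr !scalerA mulrC.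
Qed.

HB.instance Definition _ j :=
  GRing.isLinear.Build k S S *:%R (E j) (@qpartial_is_linear j).

Lemma qpartial0 f : E 0 f = f.
Proof.
by apply: ore_ext => i; rewrite ore_coef_qpartial addn0 gauss_binomial0r scale1r.
Qed.

Lemma qpartial_bound j f : (ore_bound f <= j)%N -> E j f = 0.
Proof.
move=> fj; apply: ore_ext => l; rewrite ore_coef_qpartial ore_coef_bound.
  by rewrite scaler0 linear0.
exact: leq_trans fj (leq_addl _ _).
Qed.

Lemma qpartial_const j a : E j.+1 (C a) = 0.
Proof.
apply: ore_ext => i; rewrite ore_coef_qpartial ore_coef_monomial addnS.
by rewrite scaler0 linear0.
Qed.

Lemma qpartial_constM j a g : E j (C a * g)%g = (C a * E j g)%g.
Proof.
apply: ore_ext => i.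
by rewrite !(ore_coef_qpartial, ore_coef_constM) nu_scalerAr.
Qed.

(** The coefficient of [u^j.+1] in [(x + u) g(x + u)]. *)
Lemma qpartial_x j g : E j.+1 (X g) = X (E j.+1 g) + theta (E j g).
Proof.
apply: ore_ext => -[|i]; rewrite linearD /= ore_coef_theta !ore_coef_qpartial.
  rewrite ore_coef0_x ore_coefS_x ore_coef_qpartial !gauss_binomial0l add0n.
  by rewrite !scale1r expr0 invr1 add0n scale1r [RHS]addrC.
have xS h l :
    ore_coef l.+1 (X h) = sigma (ore_coef l h) + delta (ore_coef l.+1 h).
  exact: ore_coefS_x.
rewrite !addSn !addnS !xS !ore_coef_qpartial gauss_binomialSS !addSn !addnS.
rewrite !linearZ /= !scalerDr !scalerDl scalerA -!addrA; congr (_ + _).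
by rewrite [RHS]addrA [RHS]addrC [gbin i.+1 j / _]mulrC.
Qed.

(** The shift [f(x) |-> f(x + u)] is multiplicative. *)
Lemma qpartialM m f g :
  E m (f * g)%g = \sum_(i < m.+1) (E i f * iter i theta (E (m - i) g))%g.
Proof.
move: f m; apply: ore_ind => // [f h IHf IHh m|a m|f IH m].
- rewrite nu_mulDl linearD /= IHf IHh -big_split /=; apply: eq_bigr => i _.
  by rewrite linearD /= nu_mulDl.
- rewrite big_ord_recl /= subn0 big1 ?addr0 ?qpartial0 ?qpartial_constM // => i _.
  by rewrite qpartial_const nu_mul0r.
case: m => [|m]; first by rewrite big_ord1 /= !qpartial0.
rewrite ore_xM qpartial_x !IH big_ord_recl /= qpartial0 linearD /= -ore_xM.
rewrite [RHS]big_ord_recl /= qpartial0 -addrA; congr (_ + _).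
rewrite !linear_sum /= -big_split /=; apply: eq_bigr => i _.
by rewrite /bump /= add1n subSS qpartial_x nu_mulDl ore_xM thetaM.
Qed.

Lemma qpartial_theta j f : E j (theta f) = q ^- j *: theta (E j f).
Proof.
apply: ore_ext => i.
rewrite ore_coefZ ore_coef_theta !ore_coef_qpartial ore_coef_theta.
by rewrite !linearZ /= !scalerA exprD invfM mulrAC.
Qed.

Lemma qpartial_iter_theta n j f :
  E j (iter n theta f) = q ^- (j * n) *: iter n theta (E j f).
Proof.
elim: n => [|n IH] /=; first by rewrite muln0 expr0 invr1 scale1r.
by rewrite qpartial_theta IH linearZ /= scalerA mulnS exprD invfM.
Qed.

(** * Stability of the radical under the coefficients of the shift *)

(** Modulo [J], the lowest term of [f(x + u)] has positive degree in [u]. *)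
Lemma jacobson_qpartial_power f s r i : J f -> (i < r)%N ->
  J (E i (iter r (fun t => (f * t)%g) s)).
Proof.
move=> Jf; elim: r i => //= r IH i ir; rewrite qpartialM.
apply: jacobson_sum => -[[|l] li] _.
  by apply: jacobsonMr; rewrite qpartial0.
by apply: jacobsonMl; apply: jacobson_iter_theta; apply: IH => /=; lia.
Qed.

(** Let [t] be the product of the [theta^(l e) f] for [l <= r]. Modulo [J],
    the lowest term of [f(x + u)] is [p u^j], hence that of [t(x + u)] is, up to
    a power of [q], the product of the [theta^(l e) p u^j]. Moving all the [u]
    to the right applies [theta^(j l)] to the factor of index [l], and that
    factor becomes [theta^((j + e) l) p = p]. *)
Lemma qpartial_twisted_product (j e : nat) f (p := E j f) :
  (forall i, (i < j)%N -> J (E i f)) -> iter (j + e) theta p = p ->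
  forall r (t := iter r (fun t => (f * iter e theta t)%g) f),
  (forall i, (i < j * r.+1)%N -> J (E i t)) /\
  exists2 c, c != 0 & J (E (j * r.+1) t - c *: nu_power p r).
Proof.
move=> Jf pfix; elim=> [|r [IH [c c0 IHc]]] /=.
  rewrite muln1; split=> //; exists 1; first exact: oner_neq0.
  by rewrite scale1r subrr; apply: jacobson0.
set t := iter r _ f in IH IHc *.
have Jlow l i : (i < j * r.+1)%N ->
    J (E l f * iter l theta (E i (iter e theta t)))%g.
  move=> ij; apply: jacobsonMl; apply: jacobson_iter_theta.
  rewrite qpartial_iter_theta; apply: jacobsonZ; apply: jacobson_iter_theta.
  exact: IH.
split=> [i ij|].
  rewrite qpartialM; apply: jacobson_sum => l _.
  have [lj|jl] := ltnP l j; first by apply: jacobsonMr; apply: Jf.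
  by apply: Jlow; have := ltn_ord l; rewrite mulnS in ij; lia.
exists (q ^- (j * r.+1 * e) * c).
  by rewrite mulf_neq0 // invr_neq0 // expf_neq0.
have jr : (j < (j * r.+2).+1)%N by rewrite ltnS leq_pmulr.
(* Only the term of index [j] of the product formula is not in [J]. *)
rewrite qpartialM (bigD1 (Ordinal jr)) //= addrAC.
apply: jacobsonD; last first.
  apply: jacobson_sum => l; rewrite -val_eqE /= => lj.
  have [lj'|jl] := ltnP l j; first by apply: jacobsonMr; apply: Jf.
  by apply: Jlow; move: (ltn_ord l); move: (nat_of_ord l) lj jl; lia.
have -> : (j * r.+2 - j = j * r.+1)%N by rewrite mulnS; lia.
have -> : (p * nu_power p r)%g = (p * iter (j + e) theta (nu_power p r))%g.
  congr (_ * _)%g; elim: (r) => [|r' IHr] /=; first by rewrite pfix.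
  by rewrite iter_thetaM pfix -IHr.
rewrite qpartial_iter_theta iter_thetaZ -iterD -nu_scalerAr -scalerA -scalerBr.
apply: jacobsonZ; rewrite nu_scalerAr -nu_mulBr -iter_thetaZ.
apply: jacobsonMl; have -> : iter (j + e) theta (E (j * r.+1) t) -
    iter (j + e) theta (c *: nu_power p r) =
    iter (j + e) theta (E (j * r.+1) t - c *: nu_power p r).
  by elim: (j + e)%N => //= n <-; rewrite linearB.
exact: jacobson_iter_theta.
Qed.

Hypothesis uncountable_k : ~ countable [set: k].
Hypothesis torsion_sigma : locally_torsion sigma.
Hypothesis torsion_q : exists2 e, (0 < e)%N & q ^+ e = 1.

Lemma qpartial_nilpotent f : J f ->
  exists n, forall r i, (n <= r)%N -> J (E i (nu_power f r)).
Proof.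
move=> Jf.
apply: (@nilpotent_of_quasi_invertible_scale k S S (fun i => E i) J f) => //.
- exact: jacobson0.
- exact: jacobsonD.
- by move=> c v; apply: jacobsonZ.
- move=> s; exists (ore_bound s) => i /qpartial_bound /= ->.
  exact: jacobson0.
- by move=> s i; exists i.+1 => r ir; apply: jacobson_qpartial_power.
- by move=> c; apply: jacobson_quasi_invertible; apply: jacobsonZ.
Qed.

Lemma ore_coef_iter_theta n f i :
  ore_coef i (iter n theta f) = q ^- (i * n) *: iter n sigma (ore_coef i f).
Proof.
elim: n => [|n IH] /=; first by rewrite muln0 expr0 invr1 scale1r.
by rewrite ore_coef_theta IH linearZ scalerA mulnS exprD invfM.
Qed.

Lemma theta_torsion f :
  exists m, [/\ (0 < m)%N, q ^+ m = 1 & iter m theta f = f].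
Proof.
have [m m0 Em] :=
  locally_torsion_common (fun i => ore_coef i f) (ore_bound f) torsion_sigma.
have [e e0 qe] := torsion_q.
exists (m * e)%N; split; first by rewrite muln_gt0 m0.
  by rewrite mulnC exprM qe expr1n.
apply: ore_ext => i; rewrite ore_coef_iter_theta mulnA [(i * m * e)%N]mulnC.
rewrite exprM qe expr1n invr1 scale1r.
have [/Em Ei|/ore_coef_bound ->] := ltnP i (ore_bound f).
  by rewrite mulnC; apply: iter_fixed.
exact: iter_linear0.
Qed.

(** Let [theta^m] fix [f]. With [e = (m - 1) j], the twisted product [g] of [m]
    factors is in [J], and [g(x + u)] has the lowest term [p^m u^(j m)] modulo
    [J], up to a nonzero scalar. As [theta^m] fixes [g], this term commutes with
    [u^(j m)], so its powers are the plain ones; they vanish modulo [J] because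
    [g(x + u)] is nilpotent. *)
Lemma qpartial_nilpotent_modulo j f : J f ->
  (forall i, (i < j)%N -> J (E i f)) -> exists n, J (nu_power (E j f) n).
Proof.
move=> Jf Jlow; have [m [m0 qm fm]] := theta_torsion f.
set p := E j f.
have pm : iter m theta p = p.
  have := qpartial_iter_theta m j f.
  by rewrite fm mulnC exprM qm expr1n invr1 scale1r => <-.
pose e := (m.-1 * j)%N.
have je : (j + e = j * m)%N by rewrite /e -mulSn prednK // mulnC.
have := qpartial_twisted_product Jlow (e := e).
rewrite je => /(_ (iter_fixed _ pm) m.-1).
set g := iter _ _ f; rewrite prednK // => -[glow [c c0 gp]].
have Jg : J g by rewrite /g; case: (m.-1) => //= n; apply: jacobsonMr.
have gm : iter m theta g = g.
  rewrite /g; elim: (m.-1) => //= n IH.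
  by rewrite iter_thetaM fm -iterD addnC iterD IH.
have gm' : iter (j * m + 0) theta (E (j * m) g) = E (j * m) g.
  have := qpartial_iter_theta (j * m) (j * m) g; rewrite (iter_fixed _ gm) addn0.
  rewrite [X in q ^- X]mulnA [X in q ^- X]mulnC exprM qm expr1n invr1.
  by rewrite scale1r => <-.
have [n Hn] := qpartial_nilpotent Jg.
have [_ [c' c'0]] := qpartial_twisted_product glow gm' n.
move/jacobsonN; rewrite opprB => /jacobson_sub/(_ (Hn _ _ (leqnn _))).
move/(jacobsonZ c'^-1); rewrite scalerA mulVf // scale1r => Jgn.
have := nu_powerB n gp; move/jacobsonN; rewrite opprB => /jacobson_sub/(_ Jgn).
rewrite nu_powerZ => /(jacobsonZ (c ^+ n.+1)^-1).
rewrite scalerA mulVf ?expf_neq0 // scale1r nu_power_power => Jpn.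
by eexists; exact: Jpn.
Qed.

(** By induction on [j], the set [J + E_j J] is an ideal: by [qpartialM], the
    products [r (E_j g)] and [(E_j g) (theta^j r)] are [E_j (r g)] and
    [E_j (g r)] modulo [J]. *)
Lemma jacobson_qpartial j f : J f -> J (E j f).
Proof.
elim/ltn_ind: j f => -[|j] IH f Jf; first by rewrite qpartial0.
pose K := [set y | exists2 g, J g & J (y - E j.+1 g)].
apply: (@jacobson_nil_modulo _ K); last first.
- by exists f => //; rewrite subrr; apply: jacobson0.
- move=> y [g Jg Jy].
  have [n Jn] := qpartial_nilpotent_modulo Jg (fun i ij => IH i ij g Jg).
  by exists n; apply: jacobson_sub Jn; apply: nu_powerB.
split=> [|y z [g Jg Jy] [h Jh Jz]|r y [g Jg Jy]].
- exists 0; first exact: jacobson0.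
  by rewrite linear0 subrr; apply: jacobson0.
- exists (g - h); first exact: jacobsonB.
  have -> : y - z - E j.+1 (g - h) = (y - E j.+1 g) - (z - E j.+1 h).
    by rewrite linearB /= !opprB addrACA [RHS]addrACA [- z - _]addrC.
  exact: jacobsonB.
split.
- exists (r * g)%g; first exact: jacobsonMl.
  rewrite qpartialM big_ord_recl /= qpartial0 opprD addrA -nu_mulBr.
  apply: jacobsonB; first exact: jacobsonMl.
  apply: jacobson_sum => i _; apply: jacobsonMl.
  apply: jacobson_theta; apply: jacobson_iter_theta.
  by apply: IH => //; rewrite /bump /= add1n; lia.
have [r' Er'] : exists r', iter j.+1 theta r' = r.
  elim: (j.+1) r => [|n IHn] r; first by exists r.
  by have [r1 <-] := theta_surj r; have [r2 <-] := IHn r1; exists r2.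
exists (g * r')%g; first exact: jacobsonMr.
rewrite qpartialM big_ord_recr /= subnn qpartial0 -iterS Er' opprD addrCA.
rewrite -nu_mulBl addrC; apply: jacobsonD; first by apply: jacobsonMr.
by apply: jacobsonN; apply: jacobson_sum => i _; apply: jacobsonMr; apply: IH.
Qed.

Lemma jacobson_coef f i : J f -> J (C (ore_coef i f)).
Proof.
move=> Jf; move: (@ore_coef_bound _ _ _ _ _ f) i; move: (ore_bound f) Jf => n.
elim: n f => [|n IH] f Jf fn i.
  by rewrite fn // /ore_const ore_monomial0; apply: jacobson0.
have Jn : J (C (ore_coef n f)).
  suff <- : E n f = C (ore_coef n f) by apply: jacobson_qpartial.
  apply: ore_ext => -[|l]; rewrite ore_coef_qpartial ore_coef_monomial /=.
    by rewrite gauss_binomial0l scale1r.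
  by rewrite fn ?scaler0 // addSn ltnS leq_addl.
have [->//|ni] := eqVneq i n.
have <- : ore_coef i (f - M (ore_coef n f) n) = ore_coef i f.
  by rewrite linearB /= ore_coef_monomial eq_sym (negPf ni) subr0.
apply: IH; first by apply: jacobsonB => //; apply: jacobson_monomial.
move=> l nl; rewrite linearB /= ore_coef_monomial.
by case: eqP => [->|/eqP nl']; rewrite ?subrr // subr0 fn // ltn_neqAle nl'.
Qed.

End Shift.

(** * Nilpotence of the constants in the radical *)

Section Nil.
Variables (k : fieldType) (R : nonUnitalAlgType k).
Variables (sigma delta : {linear R -> R}) (q : k).
Variables (sigmaM : {morph sigma : a b / (a * b)%g}).
Variables (deltaM : skew_derivation sigma delta).
Hypotheses (qskew : q_skew q sigma delta).
Hypothesis (nilpotent_delta : locally_nilpotent delta).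
Local Notation S := (ore sigmaM deltaM).
Local Notation C := (ore_const sigmaM deltaM).
Local Notation M := (ore_monomial sigmaM deltaM).
Local Notation X := (@ore_x R sigma delta sigmaM deltaM).
Local Notation J := (jacobson S).
Implicit Types (f g : S) (a b : R) (c : k).

Lemma iter_delta_ge m n a :
  iter m delta a = 0 -> (m <= n)%N -> iter n delta a = 0.
Proof. by move=> am mn; rewrite -(subnK mn) iterD am iter_linear0. Qed.

Lemma iter_deltaD n a b :
  iter n delta (a + b) = iter n delta a + iter n delta b.
Proof. by elim: n => //= n ->; rewrite linearD. Qed.

Lemma iter_delta_sigma n a :
  iter n delta (sigma a) = q ^+ n *: sigma (iter n delta a).
Proof.
elim: n => [|n IH] /=; first by rewrite scale1r.
by rewrite IH linearZ /= -qskew scalerA -exprSr.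
Qed.

Lemma iter_delta_mul m n a b : iter m delta a = 0 -> iter n delta b = 0 ->
  iter (m + n) delta (a * b)%g = 0.
Proof.
have [N Emn] : exists N, (m + n)%N = N by exists (m + n)%N.
rewrite Emn; elim: N m n Emn a b => [|N IH] m n Emn a b am bn.
  by have m0 : m = 0%N by [lia]; rewrite m0 in am; rewrite [a]am nu_mul0r.
rewrite iterSr deltaM iter_deltaD.
case: m am Emn => [/= -> _|m am Emn].
  by rewrite !linear0 !nu_mul0r iter_linear0 addr0.
case: n bn Emn => [/= -> _|n bn Emn].
  by rewrite linear0 !nu_mulr0 iter_linear0 addr0.
rewrite (IH m.+1 n) ?(IH m n.+1) ?addr0 //; try lia.
- by rewrite -iterSr.
- by rewrite iter_delta_sigma am linear0 scaler0.
- by rewrite -iterSr.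
Qed.

(** Give [b x^i] the order [i] minus the nilpotency index of [delta] at [b].
    All terms of [f] have order at least [v - w]. Since both [sigma b x^i.+1]
    and [delta b x^i] have a larger order than [b x^i], multiplication by [x]
    raises the order, even when [delta] lowers the degree. *)
Definition delta_order (v w : nat) f :=
  forall i n, (i + w <= n + v)%N -> iter n delta (ore_coef i f) = 0.

Lemma delta_order_x v w f : delta_order v w f -> delta_order v.+1 w (X f).
Proof.
move=> Hf [|i] n iw.
  by rewrite ore_coef0_x -iterSr; apply: Hf; lia.
rewrite ore_coefS_x iter_deltaD iter_delta_sigma -iterSr !Hf; try lia.
by rewrite linear0 scaler0 addr0.
Qed.

Lemma delta_order_const d v w a f : iter d delta a = 0 ->
  delta_order v w f -> delta_order v (w + d) (C a * f)%g.
Proof.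
move=> ad Hf i n iw; rewrite ore_coef_constM.
have [iwv|viw] := leqP (i + w) v.
  by have /= -> := Hf i 0%N iwv; rewrite nu_mulr0 iter_linear0.
apply: (@iter_delta_ge (d + (i + w - v))); last lia.
by apply: iter_delta_mul => //; apply: Hf; lia.
Qed.

Lemma delta_order_bound f : exists w, delta_order 0 w f.
Proof.
have [w Hw] : exists w, forall i, (i < ore_bound f)%N ->
    iter w delta (ore_coef i f) = 0.
  elim: (ore_bound f) => [|n [w Hw]]; first by exists 0%N.
  have [w' Hw'] := nilpotent_delta (ore_coef n f).
  exists (maxn w w') => i; rewrite ltnS leq_eqVlt => /predU1P[->|/Hw Hi].
    by apply: iter_delta_ge Hw' _; apply: leq_maxr.
  by apply: iter_delta_ge Hi _; apply: leq_maxl.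
exists w => i n iwn; have [/Hw Hi|/ore_coef_bound ->] := ltnP i (ore_bound f).
  by apply: iter_delta_ge Hi _; lia.
exact: iter_linear0.
Qed.

Lemma delta_order_monomial_power d m a v w f r : iter d delta a = 0 ->
  delta_order v w f ->
  delta_order (r * m + v) (w + r * d) (iter r (fun t => (M a m * t)%g) f).
Proof.
move=> ad Hf; elim: r => [|r IH] /=; first by rewrite addn0.
rewrite ore_monomialM !mulSn [(d + _)%N]addnC addnA -addnA.
apply: delta_order_const => //.
move: IH; move: (iter r _ f) (r * m + v)%N => g u Hg.
by elim: (m) => //= l IH; apply: delta_order_x.
Qed.

Lemma ore_lead_coef_iter_x g n m : (forall i, (n < i)%N -> ore_coef i g = 0) ->
  (forall i, (m + n < i)%N -> ore_coef i (iter m X g) = 0) /\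
  ore_coef (m + n) (iter m X g) = iter m sigma (ore_coef n g).
Proof.
move=> gn; elim: m => [|m [IH1 IH2]] //; rewrite addSn; split=> [[|i] // mi|].
  by rewrite iterS ore_coefS_x /= !IH1 ?(linear0, addr0) //; lia.
by rewrite iterS ore_coefS_x /= IH2 IH1 ?(linear0, addr0).
Qed.

Lemma ore_lead_coef_monomial_power a m r (p := nu_power (M a m) r) :
  iter m sigma a = a ->
  (forall i, (r.+1 * m < i)%N -> ore_coef i p = 0) /\
  ore_coef (r.+1 * m) p = nu_power a r.
Proof.
rewrite {}/p => am; elim: r => [|r [IH1 IH2]].
  rewrite mul1n /=; split=> [i mi|]; rewrite ore_coef_monomial ?eqxx //.
  by rewrite ltn_eqF.
rewrite iterS ore_monomialM; have [H1 H2] := ore_lead_coef_iter_x m IH1.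
split=> [i mi|]; rewrite ore_coef_constM.
  by rewrite H1 ?nu_mulr0 // -mulSn.
rewrite mulSn H2 IH2; congr (_ * _)%g; elim: (r) => //= n IH.
have iM x y : iter m sigma (x * y)%g = (iter m sigma x * iter m sigma y)%g.
  by elim: (m) => //= l ->; rewrite sigmaM.
by rewrite iM am IH.
Qed.

Lemma jacobson_const_nilpotent a :
  ~ countable [set: k] -> locally_torsion sigma -> J (C a) -> nu_nilpotent a.
Proof.
move=> uk tors Ja.
have [e [e0 ae]] := tors a; have [d ad] := nilpotent_delta a.
pose m := (d.+1 * e)%N; pose b := M a m.
have dm : (d < m)%N by rewrite /m leq_pmulr.
have am : iter m sigma a = a by apply: iter_fixed.
have Jb : J b by apply: jacobson_monomial.
have high s i : exists n, forall r, (n <= r)%N ->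
    ore_coef i (iter r (fun t => (b * t)%g) s) = 0.
  have [w Hw] := delta_order_bound s; exists (i + w)%N => r ir.
  have /(_ i 0%N) /= := @delta_order_monomial_power d m a 0 w s r ad Hw; apply.
  by have := leq_mul (leqnn r) dm; rewrite mulnS; lia.
have [||||||n Hn] := @nilpotent_of_quasi_invertible_scale k S R
    (fun i => ore_coef i : {linear S -> R}) [set 0] b uk.
- by [].
- by move=> _ _ -> ->; rewrite addr0.
- by move=> c _ ->; rewrite scaler0.
- by move=> s; exists (ore_bound s) => i /ore_coef_bound.
- by move=> s i; apply: high.
- by move=> c; apply: jacobson_quasi_invertible; apply: jacobsonZ.
exists n; have [_ <-] := ore_lead_coef_monomial_power n am.
exact: Hn.
Qed.

End Nil.

(** * The radical of the Ore extension *)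

Theorem corollary10 (k : fieldType) (R : nonUnitalAlgType k)
    (sigma delta : {linear R -> R}) (q : k)
    (sigmaM : {morph sigma : a b / (a * b)%g})
    (deltaM : skew_derivation sigma delta) :
  ~ countable [set: k] ->
  [pchar k] =i pred0 ->
  bijective sigma ->
  locally_torsion sigma ->
  locally_nilpotent delta ->
  q != 0 ->
  q_skew q sigma delta ->
  let J : set (ore sigmaM deltaM) := jacobson (ore sigmaM deltaM) in
  let JR : set R := @ore_const R sigma delta sigmaM deltaM @^-1` J in
  J = ore_coefs_in JR /\ two_sided_ideal JR /\ nil_set JR.
Proof.
move=> uk _ [sigma' _ sigmaK] tors nild q0 qskew J JR.
have [q' [q'0 q'skew q'tors]] := q_skew_root_of_unity qskew tors q0.
have ssurj b : exists a, sigma a = b by exists (sigma' b).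
split; last split.
- apply/seteqP; split=> f; last exact: jacobson_of_coefs.
  by move=> Jf i; apply: (jacobson_coef q'0 q'skew ssurj uk tors q'tors).
- split=> [|a b Ja Jb|r a Ja]; rewrite /JR /=.
  + by rewrite /ore_const ore_monomial0; apply: jacobson0.
  + have -> : ore_const sigmaM deltaM (a - b) =
        ore_const sigmaM deltaM a - ore_const sigmaM deltaM b.
      exact: monalgUB.
    exact: jacobsonB.
  + rewrite /ore_const -!ore_monomial0M.
    by split; [apply: jacobsonMl|apply: jacobsonMr].
- by move=> a; apply: jacobson_const_nilpotent qskew nild _ uk tors.
Qed.
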